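(* Let $\mathcal{K}$ be a finite simplicial complex and let $f\colon\mathcal{K}\to[0,\infty)$ be a generalized discrete Morse function with generalized discrete gradient $V$ such that $f(\{v\})=0$ for all vertices $v$, and such that $f$ takes different values on different intervals of $V$ (except the vertices). Let $\mathcal{K}_t = f^{-1}([0,t])$ for $t\ge0$. Let $N_0$ be the number of vertices of $\mathcal{K}$ and, for $k\ge1$, let $N_k$ be the number of critical $k$-simplices. Let $M_q$ be the number of finite points (points $(b,d)$ with $d<\infty$) in the $q$th persistence diagram $PD_q$ of the filtration $\{\mathcal{K}_t\}_{t\ge0}$. Then for $q\ge0$, $$M_q = N_q - N_{q-1} + \cdots + (-1)^q N_0 - \bigl(\beta_q(\mathcal{K}) - \beta_{q-1}(\mathcal{K}) + \cdots + (-1)^q\beta_0(\mathcal{K})\bigr),$$ where $\beta_k(\mathcal{K})$ is the $k$th Betti number of $\mathcal{K}$.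
   Context: Homology is simplicial homology with coefficients in a fixed field $\mathbf{k}$ (not reduced). Simplices are nonempty. For simplices $\tau\subset\sigma$ of $\mathcal{K}$, the interval is $[\tau,\sigma]=\{\alpha:\tau\subset\alpha\subset\sigma\}$ (a single simplex if $\tau=\sigma$). If $V$ is a partition of $\mathcal{K}$ into intervals, a function $f\colon\mathcal{K}\to\mathbb{R}$ is a generalized discrete Morse function with generalized discrete gradient $V$ if (i) $f(\tau)\le f(\sigma)$ whenever $\tau\subset\sigma$; and (ii) for $\tau\subset\sigma$, $f(\tau)=f(\sigma)$ holds iff $\tau$ and $\sigma$ belong to the same interval in $V$. With $\mathcal{K}_t^-=\bigcup_{s<t}\mathcal{K}_s$, for each $t>0$ one has $\mathcal{K}_t=\mathcal{K}_t^-$, or $\mathcal{K}_t=\mathcal{K}_t^-\sqcup\{\alpha\}$, or $\mathcal{K}_t=\mathcal{K}_t^-\sqcup[\tau,\sigma]$ with $\tau\subsetneq\sigma$. When a single $k$-simplex $\alpha$ is added at time $t=f(\alpha)>0$ (second case), $\alpha$ is called a critical $k$-simplex. $PD_q$ is the multiset of points $(b,d)$, $0\le b<d\le\infty$, whose counting measure $\xi_q$ satisfies $\xi_q([0,r]\times(s,\infty]) = \dim\frac{Z_q(\mathcal{K}_r)}{Z_q(\mathcal{K}_r)\cap B_q(\mathcal{K}_s)}$ for all $0\le r\le s<\infty$, where $Z_q$ and $B_q$ denote the $q$th cycle and boundary groups. *)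

(* Defs.v *)
From HB Require Import structures.
From mathcomp Require Import all_boot all_order all_algebra.

Set Implicit Arguments.
Unset Strict Implicit.
Unset Printing Implicit Defensive.

Import Order.TTheory GRing.Theory Num.Theory.
Local Open Scope ring_scope.

Section Complexes.
Variable T : finType.
Implicit Types (K L : {set {set T}}) (V I J : {set {set T}}) (s t : {set T}).

(* Not every element of T needs to be a vertex of K. *)
Definition simplicial_complex K : Prop :=
  set0 \notin K /\
  forall s t, s \in K -> t \subset s -> t != set0 -> t \in K.

Definition simplices K (k : nat) : {set {set T}} := [set s in K | #|s| == k.+1].

Definition interval t s : {set {set T}} :=
  [set a : {set T} | (t \subset a) && (a \subset s)].

Definition interval_partition K (V : {set {set {set T}}}) : Prop :=
  partition V K /\
  forall I, I \in V ->
    exists t s, [/\ t \in K, s \in K, t \subset s & I = interval t s].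

Definition vertex_interval I : Prop := exists v : T, I = [set [set v]].

End Complexes.

Section Homology.
Variables (F : fieldType) (T : finType).
Implicit Types (L : {set {set T}}) (s : {set T}).

(* The ambient space of the chains of all subcomplexes, in all degrees; the
   oriented simplices are those given by the enumeration order of T. *)
Notation chain := {ffun {set T} -> F^o}.

Definition simplex_chain s : chain := [ffun t => (t == s)%:R].

(* Homology is not reduced: the boundary of a vertex is 0, not the empty set. *)
Definition boundary_simplex s : chain :=
  if (1 < #|s|)%N then
    \sum_(v in s)
      (-1) ^+ #|[set u in s | (enum_rank u < enum_rank v)%N]|
        *: simplex_chain (s :\ v)
  else 0.

Definition boundary_fun (c : chain) : chain :=
  \sum_(s : {set T}) (c s : F) *: boundary_simplex s.

Fact boundary_fun_linear : linear boundary_fun.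
Proof.
move=> a c d; rewrite /boundary_fun scaler_sumr -big_split /=.
by apply: eq_bigr => s _; rewrite !ffunE scalerDl scalerA.
Qed.

HB.instance Definition _ :=
  GRing.isLinear.Build F chain chain _ boundary_fun boundary_fun_linear.

Definition boundary : 'End(chain) := linfun boundary_fun.

Definition chains L (q : nat) : {vspace chain} :=
  <<[seq simplex_chain s | s <- enum (simplices L q)]>>%VS.

Definition cycles L (q : nat) : {vspace chain} :=
  (chains L q :&: lker boundary)%VS.

Definition boundaries L (q : nat) : {vspace chain} :=
  (boundary @: chains L q.+1)%VS.

(* The dimension of the quotient U / W, for W a subspace of U. *)
Definition dim_quot (U W : {vspace chain}) : nat := (\dim U - \dim W)%N.

Lemma boundary_simplexE s : boundary (simplex_chain s) = boundary_simplex s.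
Proof.
rewrite lfunE /= /boundary_fun (bigD1 s) //= big1 ?addr0.
  by rewrite ffunE eqxx scale1r.
by move=> t /negPf nts; rewrite ffunE nts scale0r.
Qed.

Definition betti L (q : nat) : nat := dim_quot (cycles L q) (boundaries L q).

Let pos (v : T) (s : {set T}) :=
  #|[set u in s | (enum_rank u < enum_rank v)%N]|.

Let pos1 v w s : v \in s -> (enum_rank v < enum_rank w)%N -> 
  pos w s = (pos w (s :\ v)).+1.
Proof.
move=> vs vw; rewrite /pos (cardsD1 v) inE vs vw add1n; congr _.+1.
by apply: eq_card => u; rewrite !inE andbA.
Qed.

Let pos2 v w s : (enum_rank v < enum_rank w)%N -> pos v (s :\ w) = pos v s.
Proof.
move=> vw; apply: eq_card => u; rewrite !inE.
by case: eqP => //= ->; rewrite [(enum_rank w < _)%N]ltnNge (ltnW vw) andbF.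
Qed.


Lemma boundary_boundary s : boundary (boundary_simplex s) = 0.
Proof.
rewrite {1}/boundary_simplex; case: ifP => s1; last by rewrite linear0.
rewrite linear_sum /=.
have [s2|s2] := leqP #|s| 2.
  rewrite big1 // => v vs; rewrite linearZ /= boundary_simplexE /boundary_simplex.
  by move: s2; rewrite (cardsD1 v) vs add1n ltnS leqNgt => /negPf ->; rewrite scaler0.
pose G v w : chain := (-1) ^+ pos v s *: ((-1) ^+ pos w (s :\ v) *: simplex_chain (s :\ v :\ w)).
have GN v w : v \in s -> (enum_rank v < enum_rank w)%N -> G v w = - G w v.
  move=> vs vw; rewrite /G (pos1 vs vw) (pos2 _ vw) exprS mulN1r scaleNr opprK.
  by rewrite !scalerA mulrC; congr (_ *: simplex_chain _); apply/setP=> u; rewrite !inE andbCA.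
transitivity (\sum_(v in s) \sum_(w in s | w != v) G v w).
  apply: eq_bigr => v vs; rewrite linearZ /= boundary_simplexE /boundary_simplex.
  move: s2; rewrite (cardsD1 v) vs add1n ltnS => ->; rewrite scaler_sumr.
  by apply: eq_bigl => w; rewrite !inE andbC.
transitivity (\sum_(v in s) (\sum_(w in s | (enum_rank v < enum_rank w)%N) G v w
      + \sum_(w in s | (enum_rank w < enum_rank v)%N) G v w)).
  apply: eq_bigr => v vs; rewrite (bigID (fun w => (enum_rank v < enum_rank w)%N)) /=.
  congr (_ + _); apply: eq_bigl => w; rewrite -(inj_eq enum_rank_inj) -val_eqE /=;
    case: (w \in s) => //=; by case: ltngtP.
rewrite big_split /= [X in _ + X](exchange_big_dep (fun w => w \in s)) /=; last by move=> ? ? ? /andP[].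
rewrite -big_split big1 //= => v vs.
rewrite [X in _ + X](eq_bigl (fun w => (w \in s) && (enum_rank v < enum_rank w)%N)); last first.
  by move=> w; rewrite vs.
by rewrite -big_split big1 //= => w /andP[ws vw]; rewrite GN // addNr.
Qed.

(* In particular the truncated difference in betti is the dimension of the
   homology group. *)
Lemma boundaries_sub_cycles L q :
  simplicial_complex L -> (boundaries L q <= cycles L q)%VS.
Proof.
case=> _ Lsub; rewrite /boundaries /chains limg_span; apply/span_subvP => c.
case/mapP=> _ /mapP[s +] -> ->.
rewrite mem_enum inE boundary_simplexE => /andP[sL /eqP s_card].
rewrite memv_cap memv_ker boundary_boundary eqxx andbT.
rewrite /boundary_simplex s_card /=; apply: memv_suml => v vs.
apply/memvZ/memv_span/map_f; rewrite mem_enum inE.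
have sv_card : #|s :\ v| = q.+1 by move: s_card; rewrite (cardsD1 v) vs => -[].
rewrite sv_card eqxx andbT; apply: (Lsub s) => //; first exact: subD1set.
by rewrite -card_gt0 sv_card.
Qed.

End Homology.

From mathcomp Require Import all_classical all_reals all_analysis.

Section Morse.
Variables (R : realType) (T : finType).
Implicit Types (K : {set {set T}}) (V : {set {set {set T}}}) (f : {set T} -> R).
Implicit Types (s t : {set T}).

(* A function K -> R is a function on all sets of T whose values outside K are
   irrelevant. *)
Definition generalized_discrete_morse K V f : Prop :=
  [/\ interval_partition K V,
      forall t s, t \in K -> s \in K -> t \subset s -> f t <= f s
    & forall t s, t \in K -> s \in K -> t \subset s ->
        (f t = f s <-> exists I, [/\ I \in V, t \in I & s \in I])].

Definition distinct_values V f : Prop :=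
  forall I J, I \in V -> J \in V -> I != J ->
    ~ vertex_interval I -> ~ vertex_interval J ->
    forall s t, s \in I -> t \in J -> f s != f t.

Definition sublevel K f (r : R) : {set {set T}} :=
  finset (fun s => (s \in K) && (0 <= f s <= r)).

Definition strict_sublevel K f (r : R) : {set {set T}} :=
  finset (fun s => `[< exists r', 0 <= r' < r /\ s \in sublevel K f r' >]).

Definition critical K f (k : nat) (a : {set T}) : bool :=
  [&& a \in simplices K k, 0 < f a, a \notin strict_sublevel K f (f a) &
      sublevel K f (f a) == a |: strict_sublevel K f (f a)].

Definition num_critical K f (k : nat) : nat :=
  if k is 0 then #|simplices K 0| else #|finset (critical K f k)|.

End Morse.

Section Persistence.
Variable R : realType.

(* A multiset of points (b, d) is its multiplicity function. *)
Definition counting (PD : R * \bar R -> nat) (A : set (R * \bar R)) : \bar R :=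
  (\esum_(p in A) ((PD p)%:R%:E))%E.

Definition is_persistence_diagram (F : fieldType) (T : finType)
    (K : {set {set T}}) (f : {set T} -> R) (q : nat)
    (PD : R * \bar R -> nat) : Prop :=
  (forall b d, (0 < PD (b, d))%N -> 0 <= b /\ (b%:E < d)%E) /\
  (forall r s, 0 <= r -> r <= s ->
     let Z := cycles F (sublevel K f r) q in
     let B := boundaries F (sublevel K f s) q in
     counting PD [set p | 0 <= p.1 <= r /\ (s%:E < p.2)%E]%classic
     = (dim_quot Z (Z :&: B)%VS)%:R%:E).

Definition num_finite_points (PD : R * \bar R -> nat) : \bar R :=
  counting PD [set p | (p.2 < +oo)%E]%classic.

End Persistence.

(* Main.v *)
Require Import Defs.
From HB Require Import structures.
From mathcomp Require Import all_boot all_order all_algebra.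
From mathcomp Require Import all_classical all_reals all_analysis.
From mathcomp Require Import zify.

Set Implicit Arguments.
Unset Strict Implicit.
Unset Printing Implicit Defensive.

Import Order.TTheory GRing.Theory Num.Theory.
Local Open Scope ring_scope.

(** The theorem is a count of the simplices of K according to what they do to
    homology as the filtration grows. Let A be a sublevel complex and X the next
    one, with S = X \ A the simplices that enter.

    The finite points that die when A becomes X are counted by killed A X q, the
    dimension of the kernel of H_q(A) -> H_q(X). The diagram is only known
    through its masses on quadrants, but these masses are constant as long as
    the complexes are, so no point has its birth or its death strictly between
    two consecutive values of f (no_birth_in_gap, no_death_in_gap), and the mass of the
    points that die at the new value is the difference of two quadrants
    (counting_dead_by_gap). Summing over the values of f gives the number of
    finite points.

    Let rel_rank q be the rank of the boundary map from (q+1)-chains to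
    q-chains of the pair (X, A). Pure dimension counting shows that, if S has
    c + rel_rank q + rel_rank (q-1) simplices of dimension q, then
    killed q + killed (q-1) + beta_q(X) = c + beta_q(A) (killed_euler); here c
    is the dimension of the relative homology H_q(X, A). By the Morse condition,
    S is an interval [t, u] (level_interval). If t = u there is no relative
    boundary at all, and c is 1 or 0 according to whether the critical simplex t
    has dimension q (rel_rank_single). If t is a proper face of u, adding or
    removing a fixed vertex of u \ t pairs the simplices of S, and the pairing
    makes the relative complex acyclic: c = 0 (rel_rank_interval).

    Hence M_q + M_{q-1} + beta_q(K) = N_q for the total M_q (num_finite_euler),
    the induction starting at the level 0, which consists of the vertices
    (f_eq0_card, betti_vertices). Solving this recursion for M_q gives the
    alternating sums (alternating_sum). *)

(** * Chains and the dimensions of cycles and boundaries *)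

Section Chains.
Variables (F : fieldType) (T : finType).
Implicit Types (L A X S : {set {set T}}) (s t a : {set T}) (v w : T) (q : nat).

Notation chain := {ffun {set T} -> F^o}.
Notation simplex_chain := (simplex_chain F).
Notation boundary := (boundary F T).
Notation boundary_simplex := (boundary_simplex F).

Definition chains_on S : {vspace chain} :=
  <<[seq simplex_chain s | s <- enum S]>>%VS.

(** Projection of chains onto those carried by S; for S = X \ A this realises
    the quotient of the chains of X by the chains of A inside the chains of X. *)
Definition restr_fun S (c : chain) : chain :=
  [ffun s => if s \in S then c s else 0].

Fact restr_fun_linear S : linear (restr_fun S).
Proof.
move=> k c d; apply/ffunP=> s; rewrite !ffunE.
by case: ifP => // _; rewrite scaler0 addr0.
Qed.

HB.instance Definition _ S :=
  GRing.isLinear.Build F chain chain _ (restr_fun S) (restr_fun_linear S).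

Definition restr S : 'End(chain) := linfun (restr_fun S).

Lemma restrE S c s : restr S c s = if s \in S then c s else 0.
Proof. by rewrite lfunE ffunE. Qed.

Lemma chain_sum (c : chain) : c = \sum_s (c s : F) *: simplex_chain s.
Proof.
apply/ffunP=> t; rewrite sum_ffunE (bigD1 t) //= big1 => [|s /negPf nst].
  by rewrite addr0 !ffunE eqxx [RHS]mulr1.
by rewrite !ffunE eq_sym nst [LHS]mulr0.
Qed.

Lemma mem_chains_on S (c : chain) : reflect (forall s, s \notin S -> c s = 0) (c \in chains_on S).
Proof.
apply: (iffP idP) => [cS s sS|c0].
  have : (chains_on S <= lker (restr (~: S)))%VS.
    apply/span_subvP => _ /mapP[t tS ->]; rewrite mem_enum in tS.
    rewrite memv_ker; apply/eqP/ffunP => u; rewrite restrE !ffunE inE.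
    by case: eqP => [->|]; rewrite ?tS //=; case: ifP.
  move/subvP/(_ _ cS); rewrite memv_ker => /eqP/ffunP/(_ s).
  by rewrite restrE ffunE inE sS.
rewrite (chain_sum c); apply: memv_suml => s _.
have [sS|/c0 ->] := boolP (s \in S); last by rewrite scale0r mem0v.
by apply/memvZ/memv_span/map_f; rewrite mem_enum.
Qed.

Lemma dim_chains_on S : \dim (chains_on S) = #|S|.
Proof.
pose X := in_tuple [seq simplex_chain s | s <- enum S].
suff frX : free X by rewrite /chains_on (eqP (frX : free [seq _ | s <- _])) size_map -cardE.
apply/freeP => k /ffunP k0 i.
have szX : size (enum S) = size X by rewrite size_map.
have nthX (j : 'I_(size X)) : X`_j = simplex_chain (nth finset.set0 (enum S) j).
  by rewrite (nth_map finset.set0) // szX.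
have := k0 (nth finset.set0 (enum S) i); rewrite sum_ffunE (bigD1 i) //= big1.
  by rewrite nthX !ffunE eqxx addr0 [LHS]mulr1.
move=> j /negPf nji; rewrite nthX !ffunE nth_uniq ?szX ?enum_uniq //.
by rewrite eq_sym -(inj_eq val_inj) in nji; rewrite [_ == _]nji [LHS]mulr0.
Qed.

Lemma chains_onS S1 S2 : S1 \subset S2 -> (chains_on S1 <= chains_on S2)%VS.
Proof.
move/fintype.subsetP=> S12; apply/subvP => c /mem_chains_on c0; apply/mem_chains_on => s sS2.
by apply: c0; apply: contra sS2 => /S12.
Qed.

Lemma mem_simplex_chain S s : s \in S -> simplex_chain s \in chains_on S.
Proof. by move=> sS; apply/memv_span/map_f; rewrite mem_enum. Qed.

Lemma mem_simplices X q a : (a \in simplices X q) = (a \in X) && (#|a| == q.+1).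
Proof. by rewrite inE. Qed.

Lemma dim_chains L q : \dim (chains F L q) = #|simplices L q|.
Proof. exact: dim_chains_on. Qed.

Lemma simplicesS A X q : A \subset X -> simplices A q \subset simplices X q.
Proof.
move/fintype.subsetP=> AX; apply/fintype.subsetP=> s.
by rewrite !inE => /andP[/AX-> ->].
Qed.

Lemma chainsS A X q : A \subset X -> (chains F A q <= chains F X q)%VS.
Proof. by move=> AX; apply/chains_onS/simplicesS. Qed.

Lemma boundariesS A X q : A \subset X -> (boundaries F A q <= boundaries F X q)%VS.
Proof. by move=> AX; apply/limgS/chainsS. Qed.

(** The value in degree q - 1, where degree -1 carries nothing. *)
Definition prev (g : nat -> nat) q : nat := if q is q'.+1 then g q' else 0.

Lemma dim_cycles L q :
  (\dim (cycles F L q) + prev (fun k => \dim (boundaries F L k)) q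
   = #|simplices L q|)%N.
Proof.
rewrite -dim_chains -(limg_ker_dim boundary (chains F L q)); congr (_ + _)%N.
case: q => [|q] //=; apply/esym/eqP.
rewrite dimv_eq0 -subv0 limg_span; apply/span_subvP => _ /mapP[_ /mapP[s + ->] ->].
rewrite mem_enum inE boundary_simplexE /boundary_simplex => /andP[_ /eqP->].
exact: mem0v.
Qed.

(** Rank-nullity for the boundary map on q-chains: it is what replaces the
    truncated difference in the definition of betti. *)
Lemma betti_add L q : simplicial_complex L ->
  (betti F L q + \dim (boundaries F L q)
   + prev (fun k => \dim (boundaries F L k)) q = #|simplices L q|)%N.
Proof.
move=> cL; rewrite -dim_cycles /betti /dim_quot subnK //.
exact/dimvS/boundaries_sub_cycles.
Qed.

(** * Rank of the relative boundary map *)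

Lemma card_simplicesD A X q : A \subset X ->
  (#|simplices (X :\: A) q| + #|simplices A q| = #|simplices X q|)%N.
Proof.
move=> AX; rewrite -(cardsID A (simplices X q)) addnC; congr (_ + _)%N.
  apply: eq_card => s; rewrite !inE.
  by case: (boolP (s \in A)) => [/(fintype.subsetP AX)->|]; rewrite ?andbF ?andbT.
by apply: eq_card => s; rewrite !inE; case: (s \in A); rewrite //= ?andbT.
Qed.

(** The rank of the boundary map of the pair (X, A) from degree q + 1 to
    degree q. *)
Definition rel_rank A X q := \dim (restr (X :\: A) @: boundaries F X q)%VS.

Lemma lker_restr_chains A X q : A \subset X ->
  (chains F X q :&: lker (restr (X :\: A)))%VS = chains F A q.
Proof.
move=> AX; apply/vspaceP => c; rewrite memv_cap memv_ker.
apply/andP/mem_chains_on => [[/mem_chains_on cX /eqP/ffunP cA] s|cA].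
  move=> sA; have [sX|/cX //] := boolP (s \in simplices X q).
  move: sX sA (cA s); rewrite restrE ffunE !inE => /andP[-> ->].
  by rewrite !andbT => ->.
split; first by apply/(subvP (chainsS _ AX))/mem_chains_on.
apply/eqP/ffunP=> s; rewrite restrE ffunE; case: ifP => //; rewrite inE => /andP[sA _].
by apply: cA; rewrite inE (negPf sA).
Qed.

(** The boundaries of X that vanish on X \ A are exactly those lying in A, and
    they are then cycles of A; this is rank-nullity for the projection restricted
    to the boundaries of X. *)
Lemma killed_rel_rank A X q : A \subset X -> simplicial_complex X ->
  (\dim (cycles F A q :&: boundaries F X q) + rel_rank A X q
   = \dim (boundaries F X q))%N.
Proof.
move=> AX cX; rewrite -(limg_ker_dim (restr (X :\: A)) (boundaries F X q)).
congr (\dim _ + _)%N; rewrite /cycles -(lker_restr_chains q AX).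
apply/vspaceP => c; rewrite !memv_cap.
have [/(subvP (boundaries_sub_cycles F q cX))|] := boolP (c \in boundaries F X q).
  by rewrite memv_cap => /andP[-> ->]; rewrite !andbT.
by rewrite andbF.
Qed.

(** The relative boundary map squares to zero: the relative boundaries in degree
    q + 1, of dimension rel_rank (q + 1), lie in the relative cycles, whose
    codimension in the relative chains is rel_rank q. *)
Lemma rel_rankD A X q : A \subset X -> simplicial_complex A -> simplicial_complex X ->
  (rel_rank A X q + rel_rank A X q.+1 <= #|simplices (X :\: A) q.+1|)%N.
Proof.
move=> AX cA cX; pose P := restr (X :\: A).
(* The chains of X with boundary in A: relative cycles before dividing by the
   chains of A. *)
pose W := (chains F X q.+1 :&: lker (P \o boundary))%VS.
have dW : (\dim W + rel_rank A X q = #|simplices X q.+1|)%N.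
  by rewrite -dim_chains -(limg_ker_dim (P \o boundary) (chains F X q.+1)) limg_comp.
have nAX := card_simplicesD q.+1 AX.
have AW : (chains F A q.+1 <= W)%VS.
  apply/subvP => c cAq; rewrite memv_cap (subvP (chainsS _ AX)) //= memv_ker comp_lfunE.
  have : boundary c \in chains F A q.
    have: boundary c \in boundaries F A q by apply: memv_img.
    by move/(subvP (boundaries_sub_cycles F q cA)); rewrite memv_cap => /andP[].
  by rewrite -(lker_restr_chains q AX) memv_cap => /andP[_]; rewrite memv_ker.
have BW : (boundaries F X q.+1 <= W)%VS.
  apply: subv_trans (boundaries_sub_cycles F _ cX) _; apply: capvS => //.
  by apply/subvP => c; rewrite !memv_ker comp_lfunE => /eqP->; rewrite linear0.
have WX : (W <= chains F X q.+1)%VS by apply: capvSl.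
have WA : (W :&: lker P)%VS = chains F A q.+1.
  apply/eqP; rewrite eqEsubv; apply/andP; split.
    by rewrite -(lker_restr_chains _ AX); apply: capvS.
  by rewrite subv_cap AW -(lker_restr_chains _ AX) capvSr.
have := limg_ker_dim P W; rewrite WA dim_chains => dPW.
have PB : (rel_rank A X q.+1 <= \dim (P @: W))%N by apply/dimvS/limgS.
have count (w e e' n a x p : nat) :
  (w + e = x -> n + a = x -> a + p = w -> e' <= p -> e + e' <= n)%N by lia.
exact: count dW nAX dPW PB.
Qed.

Lemma rel_rank_le A X q : simplicial_complex X ->
  (rel_rank A X q <= #|simplices (X :\: A) q|)%N.
Proof.
move=> cX; rewrite -dim_chains; apply: dimvS; apply/subvP => _ /memv_imgP[c cB ->].
have /subvP/(_ _ cB) := boundaries_sub_cycles F q cX.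
rewrite memv_cap => /andP[/mem_chains_on c0 _]; apply/mem_chains_on => s.
rewrite restrE; case: ifP => // sXA; rewrite inE sXA /= => sq.
by apply: c0; rewrite inE (negPf sq) andbF.
Qed.

(* boundary coefficients *)
(** Only the support of the boundary matters for the rank computations; together
    with boundary_simplex_face this dispenses with the signs. *)
Lemma boundary_simplex_supp a s :
  boundary_simplex s a != 0 -> exists2 v, v \in s & a = s :\ v.
Proof.
rewrite /boundary_simplex; case: ifP => _; last by rewrite ffunE eqxx.
rewrite sum_ffunE => ne0.
have [/exists_inP[v vs /eqP]|] := boolP [exists v in s, a == s :\ v]; first by exists v.
move/exists_inPn => na; case/eqP: ne0; apply: big1 => v /na /negPf av.
by rewrite !ffunE av [LHS]mulr0.
Qed.

Lemma boundary_simplex_face v a : v \notin a -> a != finset.set0 ->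
  boundary_simplex (v |: a) a != 0.
Proof.
move=> va a0; have va0 : (v |: a) :\ v = a by rewrite setU1K.
rewrite /boundary_simplex cardsU1 va -{1}[1%N]addn0 ltn_add2l card_gt0 a0.
rewrite sum_ffunE (bigD1 v) ?setU11 //= big1 ?addr0.
  by rewrite !ffunE va0 eqxx [_ *: _]mulr1 signr_eq0.
move=> w /andP[wva wv]; rewrite !ffunE; case: eqP => [aE|_]; last by rewrite [LHS]mulr0.
by case/negP: va; rewrite aE !inE eqxx eq_sym wv.
Qed.

(** When a single simplex a enters, it is not a proper face of any simplex of X,
    since such a coface would have to enter as well; so no boundary involves a. *)
Lemma rel_rank_single A X a q : simplicial_complex A -> simplicial_complex X ->
  X :\: A = [set a]%SET -> rel_rank A X q = 0%N.
Proof.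
move=> [_ cA] [X0 _] XA; apply/eqP; rewrite dimv_eq0 -subv0 /boundaries limg_span.
rewrite limg_span; apply/span_subvP => _ /mapP[_ /mapP[_ /mapP[s + ->] ->] ->].
rewrite mem_enum inE => /andP[sX _]; rewrite boundary_simplexE memv0; apply/eqP/ffunP => u.
rewrite restrE ffunE XA inE; case: eqP => // ->.
apply/eqP; apply: contraT => /boundary_simplex_supp[v vs aE].
have : a \in X :\: A by rewrite XA inE.
rewrite inE => /andP[aA aX].
have a0 : a != finset.set0 by apply: contraNneq X0 => <-.
have sA : s \notin A by apply: contra aA => sA; apply: cA sA _ a0; rewrite aE subD1set.
have : s \in X :\: A by rewrite inE sA.
by rewrite XA inE => /eqP sa; move: vs; rewrite sa aE !inE eqxx.
Qed.

(** * Acyclicity of the relative complex of an interval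

    The simplices of S = X \ A are paired by adding and removing a vertex v. A
    simplex without v is recovered from the boundary of its partner, which
    bounds rel_rank below by the number of pairs; the inequality rel_rankD
    forces equality. *)

Section Toggle.
Variables (A X : {set {set T}}) (v : T).
Hypotheses (AX : A \subset X) (cA : simplicial_complex A) (cX : simplicial_complex X).
Hypothesis toggle : forall a, v \notin a -> (v |: a \in X :\: A) = (a \in X :\: A).
Hypothesis vS : [set v]%SET \notin X :\: A.

Let lower q : {set {set T}} := finset (fun a => (a \in simplices (X :\: A) q) && (v \notin a)).

Let card_upper q :
  #|finset (fun a => (a \in simplices (X :\: A) q) && (v \in a))| = prev (fun k => #|lower k|) q.
Proof.
case: q => [|q] /=.
  apply: eq_card0 => a; rewrite !inE; apply: contraNF vS => /andP[/andP[aS /cards1P[w aw]]].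
  by rewrite aw inE => /eqP->; rewrite inE -aw.
rewrite -(card_in_imset (f := fun a => v |: a) (D := lower q)); last first.
  move=> a b; rewrite !inE => /andP[_ va] /andP[_ vb] ab.
  by rewrite -(setU1K va) ab setU1K.
apply: eq_card => a; rewrite inE; apply/andP/imsetP => [[aS va]|[b + ->]].
  have aE := finset.setD1K va; exists (a :\ v) => //.
  move: aS; rewrite -{1}aE inE toggle ?setD11 // cardsU1 setD11 add1n eqSS => /andP[aS aq].
  by rewrite inE setD11 andbT mem_simplices aS.
rewrite inE setU11 => /andP[+ vb]; rewrite inE => /andP[bS bq]; split=> //.
by rewrite inE toggle // bS cardsU1 vb add1n eqSS.
Qed.

Let card_toggle q :
  (#|simplices (X :\: A) q| = #|lower q| + prev (fun k => #|lower k|) q)%N.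
Proof.
rewrite -card_upper -(cardsID (finset (fun a => v \in a)) (simplices (X :\: A) q)) addnC.
by congr (_ + _)%N; apply: eq_card => a; rewrite !inE; case: (v \in a); rewrite ?andbF ?andbT.
Qed.

(* After projection to the simplices of S without v, the boundary of v |: a is
   a nonzero multiple of a, as all its other faces contain v. *)
Let lower_le q : (#|lower q| <= rel_rank A X q)%N.
Proof.
rewrite -dim_chains_on /rel_rank; pose P := restr (X :\: A).
rewrite -(limg_ker_dim (restr (lower q)) (P @: boundaries F X q)).
apply: leq_trans (leq_addl _ _).
apply: dimvS; apply/span_subvP => _ /mapP[a + ->]; rewrite mem_enum => al.
have [/andP[aS aq] va] : (a \in X :\: A) && (#|a| == q.+1) /\ v \notin a.
  by move: al; rewrite inE => /andP[]; rewrite inE.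
have a0 : a != finset.set0 by rewrite -card_gt0 (eqP aq).
have k0 := boundary_simplex_face va a0; set k : F := _ a in k0.
suff -> : simplex_chain a =
    k^-1 *: restr (lower q) (P (boundary (simplex_chain (v |: a)))).
  apply/memvZ/memv_img/memv_img/memv_img/mem_simplex_chain.
  have : v |: a \in X :\: A by rewrite toggle.
  rewrite !inE cardsU1 va add1n eqSS aq andbT; by case/andP.
apply/ffunP => b; rewrite boundary_simplexE !(ffunE, restrE).
have [->|ba] := eqVneq b a.
  rewrite al aS [RHS]mulVf //.
case: ifP => bl; last by rewrite scaler0.
have /andP[bS vb] : (b \in X :\: A) && (v \notin b).
  by move: bl; rewrite inE => /andP[+ ->]; rewrite inE => /andP[->].
rewrite bS; have [->|] := eqVneq (boundary_simplex (v |: a) b) 0; first by rewrite scaler0.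
case/boundary_simplex_supp => w wva bE; case/eqP: ba; move: vb; rewrite bE !inE eqxx /= andbT.
by rewrite negbK => /eqP<-; rewrite setU1K.
Qed.

Lemma rel_rank_toggle q :
  (#|simplices (X :\: A) q| = rel_rank A X q + prev (rel_rank A X) q)%N.
Proof.
suff eE k : rel_rank A X k = #|lower k| by rewrite card_toggle eE; case: q => //= q; rewrite eE.
apply/eqP; rewrite eqn_leq lower_le andbT; case: k => [|k].
  by have := rel_rank_le A 0 cX; rewrite card_toggle addn0.
have := rel_rankD k AX cA cX; rewrite card_toggle /= addnC => /leq_trans.
move/(_ (#|lower k.+1| + rel_rank A X k)%N); rewrite leq_add2r; apply.
by rewrite leq_add2l lower_le.
Qed.

End Toggle.

(** Any vertex of s outside t toggles the interval; the pairing misses no simplex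
    because t is nonempty, so that the vertex alone is not in the interval. *)
Lemma rel_rank_interval A X s t q :
  A \subset X -> simplicial_complex A -> simplicial_complex X ->
  X :\: A = Defs.interval t s -> t \proper s ->
  (#|simplices (X :\: A) q| = rel_rank A X q + prev (rel_rank A X) q)%N.
Proof.
move=> AX cA cX XA /fintype.properP[ts [v vs vt]]; apply: (rel_rank_toggle (v := v)) => //.
  move=> a va; rewrite XA !inE finset.subUset finset.sub1set vs; congr (_ && _).
  apply/fintype.subsetP/fintype.subsetP => ta x xt; have := ta x xt; rewrite !inE.
    by case: eqP => // xv; rewrite -xv xt in vt.
  by move=> ->; rewrite orbT.
rewrite XA inE negb_and finset.subset1; apply/orP; left; apply/norP; split.
  by apply: contraNneq vt => ->; rewrite inE.
have : t \in X :\: A by rewrite XA inE fintype.subxx.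
by rewrite inE => /andP[_ tX]; case: cX => X0 _; apply: contraNneq X0 => <-.
Qed.

(** * Kernel of the map induced in homology by an inclusion *)

(** The dimension of the kernel of H_q(A) -> H_q(X): the cycles of A that bound in
    X, modulo those that bound in A. *)
Definition killed A X q : nat :=
  (\dim (cycles F A q :&: boundaries F X q) - \dim (boundaries F A q))%N.

(** The dimension count of the long exact sequence of the pair (X, A); the
    hypothesis says that c is the dimension of H_q(X, A). *)
Lemma killed_euler A X (c : nat) q :
  A \subset X -> simplicial_complex A -> simplicial_complex X ->
  (#|simplices (X :\: A) q| = c + rel_rank A X q + prev (rel_rank A X) q)%N ->
  (killed A X q + prev (killed A X) q + betti F X q = c + betti F A q)%N.
Proof.
move=> AX cA cX cE.
have kE k : (killed A X k + \dim (boundaries F A k) + rel_rank A X k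
             = \dim (boundaries F X k))%N.
  rewrite subnK ?killed_rel_rank //; apply: dimvS.
  by rewrite subv_cap boundaries_sub_cycles // boundariesS.
have kpE : (prev (killed A X) q + prev (fun k => \dim (boundaries F A k)) q
     + prev (rel_rank A X) q = prev (fun k => \dim (boundaries F X k)) q)%N.
  by case: q {cE} => //= k; apply: kE.
have := card_simplicesD q AX; have := betti_add q cA; have := betti_add q cX.
have := kE q; move: kpE cE.
set a1 := prev _ q; set a2 := prev _ q; set a3 := prev _ q; set a4 := prev _ q.
set b1 := killed _ _ _; set b2 := \dim _; set b3 := rel_rank _ _ _; set b4 := \dim _.
set c1 := betti _ _ _; set c2 := #|_|; set c3 := betti _ _ _; set c4 := #|_|.
set c5 := #|_|; lia.
Qed.

End Chains.

(** * Sublevel complexes of a generalized discrete Morse function *)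

Section MorseLevels.
Variables (R : realType) (F : fieldType) (T : finType).
Variables (K : {set {set T}}) (V : {set {set {set T}}}) (f : {set T} -> R).
Hypotheses (cK : simplicial_complex K) (f_ge0 : forall s, s \in K -> 0 <= f s).
Hypothesis f_morse : generalized_discrete_morse K V f.
Hypothesis f_vertex : forall v : T, [set v]%SET \in K -> f [set v]%SET = 0.
Hypothesis f_distinct : distinct_values V f.
Implicit Types (r : R) (s t a x : {set T}) (q : nat).

Lemma mem_sublevel r s : (s \in sublevel K f r) = (s \in K) && (f s <= r).
Proof. by rewrite inE; case sK: (s \in K) => //=; rewrite f_ge0. Qed.

Lemma sublevel_complex r : simplicial_complex (sublevel K f r).
Proof.
case: cK => K0 Kf; case: f_morse => _ fmono _; split=> [|s t].
  by rewrite mem_sublevel (negPf K0).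
rewrite !mem_sublevel => /andP[sK sr] ts t0; have tK := Kf s t sK ts t0.
by rewrite tK (le_trans (fmono _ _ tK sK ts)).
Qed.

Lemma sublevelS r r' : r <= r' -> sublevel K f r \subset sublevel K f r'.
Proof.
move=> rr'; apply/fintype.subsetP => s; rewrite !mem_sublevel => /andP[-> sr].
exact: le_trans rr'.
Qed.

Lemma vertex_mem s v : s \in K -> v \in s -> [set v]%SET \in K.
Proof.
case: cK => _ Kf sK vs; apply: Kf sK _ _; first by rewrite finset.sub1set.
by rewrite -card_gt0 cards1.
Qed.

Lemma mem_block s : s \in K -> exists2 I, I \in V & s \in I.
Proof.
case: f_morse => [[/and3P[/eqP covV _ _] _] _ _].
by rewrite -covV => /bigcupP[I IV sI]; exists I.
Qed.

Lemma block_sub I s : I \in V -> s \in I -> s \in K.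
Proof.
case: f_morse => [[/and3P[/eqP covV _ _] _] _ _] IV sI.
by rewrite -covV; apply/bigcupP; exists I.
Qed.

Lemma block_uniq I J s : I \in V -> J \in V -> s \in I -> s \in J -> I = J.
Proof.
case: f_morse => [[/and3P[_ /finset.trivIsetP tV _] _] _ _] IV JV sI sJ.
apply/eqP; apply: contraT => /(tV _ _ IV JV); rewrite -setI_eq0 => /eqP/setP/(_ s).
by rewrite inE sI sJ inE.
Qed.

(** All the vertices of s have the value 0 too, so each of them lies in the
    interval of s; the lower end of that interval is then contained in every
    vertex of s, and it is nonempty. *)
Lemma f_eq0_card s : s \in K -> f s = 0 -> #|s| = 1%N.
Proof.
move=> sK fs; have K0 : finset.set0 \notin K by case: cK.
have s0 : s != finset.set0 by apply: contraNneq K0 => <-.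
case: (f_morse) => [[_ Vint] _ fV].
have blk v : v \in s -> exists I, [/\ I \in V, [set v]%SET \in I & s \in I].
  move=> vs; have vK := vertex_mem sK vs.
  by apply/(fV _ _ vK sK); rewrite ?finset.sub1set // fs f_vertex.
have /finset.set0Pn[v vs] := s0; apply/eqP; apply/cards1P; exists v.
apply/eqP; rewrite finset.eqEsubset finset.sub1set vs andbT; apply/fintype.subsetP => w ws.
have [I [IV vI sI]] := blk v vs; have [J [JV wJ sJ]] := blk w ws.
rewrite -(block_uniq IV JV sI sJ) in wJ; have [t [u [tK _ _ IE]]] := Vint I IV.
move: vI wJ; rewrite IE !inE => /andP[tv _] /andP[tw _].
have /finset.set0Pn[x xt] : t != finset.set0 by apply: contraNneq K0 => <-.
by move: (fintype.subsetP tv x xt) (fintype.subsetP tw x xt); rewrite !inE => /eqP-> /eqP->.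
Qed.

Definition level r : {set {set T}} := finset (fun x => (x \in K) && (f x == r)).

(** An interval of the gradient on which f is positive is not a vertex interval, so
    no other interval carries the same value. *)
Lemma level_interval s : s \in K -> 0 < f s ->
  exists t u : {set T}, t \subset u /\ level (f s) = Defs.interval t u.
Proof.
move=> sK fs; have [I IV sI] := mem_block sK.
have nv J x : J \in V -> x \in J -> 0 < f x -> ~ vertex_interval J.
  move=> JV xJ fx [v JE]; have xK := block_sub JV xJ.
  by move: xJ fx; rewrite JE inE => /eqP xE; rewrite xE f_vertex ?ltxx -?xE.
case: (f_morse) => [[_ Vint] fmono fV].
have [t [u [tK uK tu IE]]] := Vint I IV; exists t, u; split=> //.
have tI : t \in I by rewrite IE inE fintype.subxx.
have uI : u \in I by rewrite IE inE fintype.subxx andbT.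
have ftu : f t = f u by apply/fV => //; exists I.
have fI x : x \in I -> f x = f t.
  move=> xI; have xK := block_sub IV xI.
  move: xI; rewrite IE inE => /andP[tx xu]; apply: le_anti.
  by rewrite {1}ftu !fmono.
rewrite -IE; apply/setP => x; rewrite inE; apply/andP/idP => [[xK /eqP fx]|xI]; last first.
  by rewrite (block_sub IV xI) (fI _ xI) (fI _ sI).
have [J JV xJ] := mem_block xK; have [->//|IJ] := eqVneq I J.
have nvJ : ~ vertex_interval J by apply: nv JV xJ _; rewrite fx.
by have := f_distinct IV JV IJ (nv _ _ IV sI fs) nvJ sI xJ; rewrite fx eqxx.
Qed.

Lemma mem_strict_sublevel r s : (s \in strict_sublevel K f r) = (s \in K) && (f s < r).
Proof.
rewrite inE; apply/asboolP/andP => [[r' [/andP[_ r'r]]]|[sK sr]].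
  by rewrite mem_sublevel => /andP[-> sr']; split=> //; apply: le_lt_trans r'r.
by exists (f s); rewrite f_ge0 // sr mem_sublevel sK lexx.
Qed.

(** The strict sublevel complex at f a consists of everything below f a, so that
    the decomposition asked of a critical simplex says that its level set is a
    singleton. *)
Lemma criticalE q a :
  critical K f q a = [&& a \in simplices K q, 0 < f a & level (f a) == [set a]%SET].
Proof.
rewrite /critical; case: (boolP (a \in _)) => //=; rewrite mem_simplices => /andP[aK _].
case: (0 < f a) => //=; rewrite mem_strict_sublevel ltxx andbF /=.
apply/eqP/eqP => /setP lE; apply/setP => x; have := lE x;
  rewrite in_setU1 mem_sublevel mem_strict_sublevel [x \in level _]inE inE;
  have [->|_] := eqVneq x a; rewrite ?aK ?lexx ?eqxx //=;
  by case: (x \in K) => //=; case: ltgtP.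
Qed.

Lemma simplices_level r : 0 < r -> simplices (level r) 0 = finset.set0.
Proof.
move=> r0; apply/setP => a; rewrite mem_simplices inE [RHS]inE.
apply: contraTF r0 => /andP[/andP[aK /eqP <-] /cards1P[v aE]].
by rewrite -leNgt aE f_vertex // -aE.
Qed.

Definition critical_at q r : {set {set T}} :=
  finset (fun a => critical K f q a && (a \in level r)).

(** The partial count of critical simplices; in degree 0 all the vertices are
    counted from the start, since they all enter at time 0. *)
Definition critical_upto q r : nat :=
  if q is 0 then #|simplices K 0|
  else #|finset (fun a => critical K f q a && (f a <= r))|.

(** No value of f lies strictly between r and r'; the end points need not be
    values. *)
Definition gap r r' := forall x, x \in K -> ~~ (r < f x < r').

Lemma sublevelD_gap r r' : r < r' -> gap r r' ->
  sublevel K f r' :\: sublevel K f r = level r'.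
Proof.
move=> rr' gp; apply/setP => x; rewrite finset.in_setD !mem_sublevel [RHS]inE.
case xK: (x \in K) => //=; rewrite -ltNge; have := gp x xK.
case: (ltgtP (f x) r') => fx; rewrite ?andbT ?andbF //.
  by move=> /negPf.
by rewrite fx rr'.
Qed.

Lemma sublevel_gap r u r' : gap r r' -> r <= u -> u < r' ->
  sublevel K f u = sublevel K f r.
Proof.
move=> gp ru ur'; apply/setP => x; rewrite !mem_sublevel.
case xK: (x \in K) => //=; apply/idP/idP => fx; last exact: le_trans ru.
have := gp x xK; rewrite (le_lt_trans fx ur') andbT -leNgt //.
Qed.

Lemma critical_upto_gap q r r' : 0 < r' -> r < r' -> gap r r' ->
  critical_upto q r' =
  (#|critical_at q r'| + critical_upto q r)%N.
Proof.
move=> r'0 rr' gp; case: q => [|q]; rewrite /critical_upto.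
  rewrite (_ : #|critical_at 0 r'| = 0%N) //; apply: eq_card0 => a; rewrite !inE criticalE.
  apply/negP => /andP[/and3P[aK fa _] /andP[aK' /eqP far]].
  by have := simplices_level r'0; move/setP/(_ a); rewrite mem_simplices !inE aK' far eqxx;
    move: aK; rewrite mem_simplices => /andP[_ ->].
pose S : {set {set T}} := finset (fun a => critical K f q.+1 a && (f a <= r')).
transitivity (#|S :&: level r'| + #|S :\: level r'|)%N; first by rewrite cardsID.
congr addn; apply: eq_card => a; rewrite !inE.
  by case: eqP => [->|]; rewrite ?lexx ?andbF ?andbT.
case: (boolP (critical _ _ _ _)); rewrite ?andbF //= criticalE mem_simplices.
move=> /and3P[/andP[aK _] _ _]; rewrite aK /=; have := gp a aK.
case: (ltgtP (f a) r') => fa; rewrite ?andbT ?andbF /=.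
- by rewrite -leNgt => ->.
- by move=> _; rewrite leNgt (lt_trans rr' fa).
- by move=> _; rewrite fa leNgt rr'.
Qed.

(** The identity M_q + M_(q-1) + beta_q = N_q is preserved when one level is
    crossed: the interval that enters either is a critical simplex or has an
    acyclic relative complex. *)
Lemma killed_gap q r r' s : s \in K -> f s = r' -> 0 < r' -> r < r' -> gap r r' ->
  let A := sublevel K f r in let X := sublevel K f r' in
  (killed F A X q + prev (killed F A X) q + betti F X q + critical_upto q r
   = critical_upto q r' + betti F A q)%N.
Proof.
move=> sK fs r'0 rr' gp A X; have AX : A \subset X := sublevelS (ltW rr').
have [cA cX] : simplicial_complex A /\ simplicial_complex X.
  by split; apply: sublevel_complex.
have XA : X :\: A = level r' := sublevelD_gap rr' gp.
rewrite (critical_upto_gap q r'0 rr' gp); set c := #|critical_at q r'|.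
suff cE : (#|simplices (X :\: A) q| = c + rel_rank F A X q + prev (rel_rank F A X) q)%N.
  by rewrite (killed_euler AX cA cX cE) addnAC.
have [t [u [tu lE]]] : exists t u : {set T}, t \subset u /\ level r' = Defs.interval t u.
  by rewrite -fs; apply: level_interval => //; rewrite fs.
have [tuE|ntu] := eqVneq t u.
  have lE1 : level r' = [set t]%SET.
    by rewrite lE -tuE; apply/setP => x; rewrite !inE finset.eqEsubset andbC.
  have e0 k : rel_rank F A X k = 0%N := rel_rank_single F k cA cX (etrans XA lE1).
  have -> : prev (rel_rank F A X) q = 0%N by case: (q) => //= k.
  rewrite e0 !addn0 XA lE1; apply: eq_card => a.
  rewrite mem_simplices [RHS]inE criticalE mem_simplices lE1.
  rewrite !finset.in_set1; case: eqP => [->|_]; last by rewrite andbF.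
  have : t \in level r' by rewrite lE1 finset.set11.
  by rewrite inE => /andP[-> /eqP ->]; rewrite lE1 eqxx r'0 !andbT.
have tpu : t \proper u by rewrite finset.properEneq ntu.
rewrite (rel_rank_interval F q AX cA cX (etrans XA lE) tpu) (_ : c = 0%N) //.
apply: eq_card0 => a; rewrite inE criticalE; apply: contraNF ntu.
case/andP => /and3P[_ _ la1]; rewrite inE => /andP[_ /eqP far].
move: la1; rewrite far lE => /eqP/setP la.
have := la t; have := la u; rewrite !inE !fintype.subxx tu /= => /esym/eqP -> /esym/eqP ->.
by [].
Qed.

(** At time 0 the complex is a set of points, so it has no boundaries. *)
Lemma betti_vertices q : betti F (sublevel K f 0) q = critical_upto q 0.
Proof.
set L := sublevel K f 0; have cL : simplicial_complex L := sublevel_complex 0.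
have memL s : s \in L -> #|s| = 1%N.
  rewrite mem_sublevel => /andP[sK s0]; apply: f_eq0_card => //.
  by apply: le_anti; rewrite s0 f_ge0.
have n0 k : #|simplices L k.+1| = 0%N.
  apply: eq_card0 => a; rewrite mem_simplices; apply/negP => /andP[/memL ->] //.
have b0 k : \dim (boundaries F L k) = 0%N.
  apply/eqP; rewrite -leqn0 -(n0 k) -(dim_chains F) -[leqRHS](limg_ker_dim (boundary F T)).
  exact: leq_addl.
have := betti_add F q cL; rewrite b0 addn0 (_ : prev _ q = 0%N) ?addn0 => [->|]; last first.
  by case: q => //= k; rewrite b0.
case: q => [|q] /=.
  apply: eq_card => a; rewrite !mem_simplices mem_sublevel.
  case: (boolP (_ \in K)) => //= aK; case: cards1P => [[v aE]|_]; last by rewrite andbF.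
  by rewrite andbT aE f_vertex ?lexx // -aE.
rewrite n0; symmetry; apply: eq_card0 => a; rewrite inE criticalE.
by apply/negP => /andP[/and3P[_ + _]]; rewrite ltNge => /negPf ->.
Qed.

Lemma critical_upto_max q r : (forall x, x \in K -> f x <= r) ->
  critical_upto q r = num_critical K f q.
Proof.
move=> fr; case: q => //= q; apply: eq_card => a; rewrite !inE.
by case: (boolP (critical _ _ _ _)) => //= /and4P[/setIdP[/fr]].
Qed.

Lemma sublevel_max r : (forall x, x \in K -> f x <= r) -> sublevel K f r = K.
Proof.
move=> fr; apply/setP => x; rewrite mem_sublevel.
by case: (boolP (x \in K)) => //= /fr ->.
Qed.

(** Every positive value of f has a predecessor because 0 is a value, taken at any
    vertex of the simplex. *)
Lemma prev_value s : s \in K -> 0 < f s ->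
  exists x, [/\ x \in K, f x < f s & gap (f x) (f s)].
Proof.
move=> sK fs; have s0 : s != finset.set0 by apply: contraTneq sK => ->; case: cK.
have /finset.set0Pn[v vs] := s0; have vK := vertex_mem sK vs.
pose P := [pred x : {set T} | (x \in K) && (f x < f s)].
have vP : P [set v]%SET by rewrite /= vK f_vertex.
case: (arg_maxP f vP) => x /andP[xK xs] xmax; exists x; split=> // y yK.
by apply/negP => /andP[xy ys]; have := xmax y; rewrite /= yK ys leNgt xy => /(_ isT).
Qed.

End MorseLevels.

(** * Mass of a multiset of points *)

Section Counting.
Variables (R : realType) (PD : R * \bar R -> nat).
Implicit Types (A B : set (R * \bar R)).
Local Open Scope classical_set_scope.

Lemma counting_ge0 A : (0 <= Defs.counting PD A)%E.
Proof. by apply: esum_ge0 => p _; rewrite lee_fin. Qed.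

Lemma eq_counting A B :
  (forall p, (0 < PD p)%N -> A p <-> B p) -> Defs.counting PD A = Defs.counting PD B.
Proof.
move=> AB; rewrite /Defs.counting esum_mkcond [RHS]esum_mkcond; apply: eq_esum => p _.
have [p0|] := ltnP 0 (PD p); last by rewrite leqn0 => /eqP->; rewrite !if_same.
suff -> : (p \in A) = (p \in B) by [].
by apply/idP/idP => /set_mem pA; apply/mem_set/AB.
Qed.

Lemma countingID A B :
  Defs.counting PD A = (Defs.counting PD (A `&` B) + Defs.counting PD (A `\` B))%E.
Proof. by rewrite /Defs.counting (esumID B). Qed.

(** Two nested sets of equal finite mass: the difference has mass zero. Finiteness
    is what allows the subtraction. *)
Lemma counting_eq_no_point A B (n : nat) p : A `<=` B ->
  Defs.counting PD A = n%:R%:E -> Defs.counting PD B = n%:R%:E -> B p -> ~ A p -> PD p = 0%N.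
Proof.
move=> AB An Bn Bp nAp; move: Bn; rewrite (countingID B A) setIC (setIidl AB) An.
rewrite (countingID (B `\` A) [set p]) (_ : _ `&` [set p] = [set p]); last first.
  by apply/seteqP; split=> [x []|_ ->] //; split.
have -> : Defs.counting PD [set p] = (PD p)%:R%:E by apply: esum_set1; rewrite lee_fin.
case: (Defs.counting _ _) (counting_ge0 ((B `\` A) `\` [set p])) => [c||] //.
rewrite lee_fin => c0 [] /eqP; rewrite -subr_eq0 addrAC subrr add0r => /eqP pc.
have : (PD p)%:R <= 0 :> R by rewrite -pc lerDl.
by rewrite lern0 => /eqP.
Qed.

End Counting.

(** * Points of the persistence diagram *)

Lemma dim_quot_killed (F : fieldType) (T : finType) (A X : {set {set T}}) q :
  A \subset X -> simplicial_complex A ->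
  (dim_quot (cycles F A q) (cycles F A q :&: boundaries F A q)
   = killed F A X q + dim_quot (cycles F A q) (cycles F A q :&: boundaries F X q))%N.
Proof.
move=> AX cA; rewrite /dim_quot /killed.
have BZ := boundaries_sub_cycles F q cA; rewrite (capv_idPr BZ).
have : (boundaries F A q <= cycles F A q :&: boundaries F X q)%VS.
  by rewrite subv_cap BZ boundariesS.
move/dimvS; have /dimvS := capvSl (cycles F A q) (boundaries F X q).
by move=> dZ dB; rewrite addnC addnBA // subnK.
Qed.

Section Diagram.
Variables (R : realType) (F : fieldType) (T : finType).
Variables (K : {set {set T}}) (V : {set {set {set T}}}) (f : {set T} -> R).
Hypotheses (cK : simplicial_complex K) (f_ge0 : forall s, s \in K -> 0 <= f s).
Hypothesis f_morse : generalized_discrete_morse K V f.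
Hypothesis f_vertex : forall v : T, [set v]%SET \in K -> f [set v]%SET = 0.
Hypothesis f_distinct : distinct_values V f.
Variables (q : nat) (PD : R * \bar R -> nat).
Hypothesis hPD : is_persistence_diagram F K f q PD.
Implicit Types (r s b : R) (d : \bar R).
Local Open Scope classical_set_scope.

Definition quadrant r s : set (R * \bar R) :=
  [set p | 0 <= p.1 <= r /\ (s%:E < p.2)%E].

Lemma counting_quadrant r s : 0 <= r -> r <= s ->
  Defs.counting PD (quadrant r s) =
  (dim_quot (cycles F (sublevel K f r) q)
     (cycles F (sublevel K f r) q :&: boundaries F (sublevel K f s) q)%VS)%:R%:E.
Proof. by move=> r0 rs; have [_ ->] := hPD. Qed.

(** The quadrants with corners (r, b) and (b, b) have the same mass because the
    complex does not change from r to b, and only the second one contains (b, d). *)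
Lemma no_birth_in_gap r r' b d : 0 <= r -> gap K f r r' ->
  (0 < PD (b, d))%N -> r < b -> r' <= b.
Proof.
move=> r0 gp pd rb; rewrite leNgt; apply/negP => br'.
have [b0 bd] := hPD.1 _ _ pd; have bE := sublevel_gap f_ge0 gp (ltW rb) br'.
suff : PD (b, d) = 0%N by move: pd => /[swap] ->.
apply: (counting_eq_no_point (A := quadrant r b) (B := quadrant b b)) => //=.
- by move=> p [/andP[p0 pr] pb]; split=> //; rewrite p0 (le_trans pr) ?ltW.
- by rewrite counting_quadrant // ltW.
- by rewrite counting_quadrant // bE.
- by rewrite /quadrant /= b0 lexx.
- by case=> /andP[_]; rewrite leNgt rb.
Qed.

(** For b <= r, the quadrants with corners (r, r) and (r, d) have the same mass, and
    only the first one contains (b, d); a birth after r is not before r'. *)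
Lemma no_death_in_gap r r' b (d : R) : 0 <= r -> gap K f r r' ->
  (0 < PD (b, d%:E))%N -> r < d -> r' <= d.
Proof.
move=> r0 gp pd rd; have [b0] := hPD.1 _ _ pd; rewrite lte_fin => bd.
have [br|rb] := leP b r; last first.
  exact: le_trans (no_birth_in_gap r0 gp pd rb) (ltW bd).
rewrite leNgt; apply/negP => dr'.
have dE := sublevel_gap f_ge0 gp (ltW rd) dr'.
suff : PD (b, d%:E) = 0%N by move: pd => /[swap] ->.
apply: (counting_eq_no_point (A := quadrant r d) (B := quadrant r r)) => //=.
- by move=> p [pr pd']; split=> //; apply: lt_trans pd'; rewrite lte_fin.
- by rewrite counting_quadrant // ltW.
- by rewrite counting_quadrant // dE.
- by rewrite /quadrant /= b0 br lte_fin.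
- by case; rewrite ltxx.
Qed.

Definition dead_by r : set (R * \bar R) := [set p | (p.2 <= r%:E)%E].

(** The points that die after r and by r' die at r' and are born by r, so that they
    are the difference of two quadrants with the same cycles. *)
Lemma counting_dead_by_gap r r' : 0 <= r -> r < r' -> gap K f r r' ->
  Defs.counting PD (dead_by r') =
  (Defs.counting PD (dead_by r)
   + (killed F (sublevel K f r) (sublevel K f r') q)%:R%:E)%E.
Proof.
move=> r0 rr' gp; rewrite (countingID _ _ (dead_by r)); congr (_ + _)%E.
  apply: eq_counting => p _; split=> [[]//|pr]; split=> //.
  by apply: le_trans pr _; rewrite lee_fin ltW.
transitivity (Defs.counting PD (quadrant r r `\` quadrant r r')).
  apply: eq_counting => -[b [d| |]] pd; have [b0 bd] := hPD.1 _ _ pd => //; last first.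
  - by split=> [[]//|[[+ _] nq]] => br; case: nq; split; rewrite //= ltry.
  rewrite /quadrant /dead_by /= !lee_fin !lte_fin; split=> [[dr' /negP]|[[br rd] nq]].
    rewrite -ltNge => rd; have dE : d = r'.
      by apply: le_anti; rewrite dr' (no_death_in_gap r0 gp pd rd).
    rewrite b0 /=; split; last by rewrite dE ltxx => -[].
    split=> //; rewrite leNgt; apply/negP => rb.
    have := no_birth_in_gap r0 gp pd rb; rewrite leNgt -dE.
    by move: bd; rewrite lte_fin => ->.
  split; last by apply/negP; rewrite -ltNge.
  by rewrite leNgt; apply/negP => r'd; case: nq.
have := countingID PD (quadrant r r) (quadrant r r').
rewrite setIidr; last first.
  by move=> p [pr pd]; split=> //; apply: lt_trans pd; rewrite lte_fin.
rewrite (counting_quadrant r0 (lexx r)) (counting_quadrant r0 (ltW rr')).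
rewrite (dim_quot_killed F q (sublevelS f_ge0 (ltW rr'))); last first.
  exact: sublevel_complex cK f_ge0 f_morse _.
set m := killed _ _ _ _; set n := dim_quot _ _.
case: (Defs.counting _ _) (counting_ge0 PD (quadrant r r `\` quadrant r r')) => [c||] // _.
case=> mc; congr (_%:E); apply: (@addrI _ n%:R); rewrite [RHS]addrC -natrD mc; exact: erefl.
Qed.

(** Induction on the values of f, through the number of simplices already present.
    The numbers M k in all degrees are carried along, although the diagram is in
    degree q, because the recursion relates consecutive degrees. *)
Lemma dead_by_euler r : 0 <= r -> r = 0 \/ (exists2 s, s \in K & f s = r) ->
  exists M : nat -> nat,
    (forall k, M k + prev M k + betti F (sublevel K f r) k = critical_upto K f k r)%N
    /\ Defs.counting PD (dead_by r) = (M q)%:R%:E.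
Proof.
have [n] := ubnP #|sublevel K f r|; elim: n r => // n IHn r Kn r0 rval.
have [r_eq0|rn0] := eqVneq r 0.
  exists (fun=> 0%N); split=> [k|].
    by rewrite r_eq0 (betti_vertices F cK f_ge0 f_morse f_vertex) //; case: k.
  rewrite /Defs.counting esum1 // => -[b d] /=; rewrite r_eq0 => d0.
  have [-> //|pd] := posnP (PD (b, d)); have [b0 bd] := hPD.1 _ _ pd.
  by have := lt_le_trans bd d0; rewrite lte_fin ltNge b0.
have r_gt0 : 0 < r by rewrite lt_neqAle eq_sym rn0.
case: rval => [rE|[s sK fs]]; first by rewrite rE eqxx in rn0.
have [|x [xK]] := prev_value cK f_vertex sK; rewrite fs // => xr gp.
have [|||M [ME MC]] := IHn (f x); [|exact: f_ge0|by right; exists x|].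
  rewrite -ltnS; apply: leq_trans Kn; apply: proper_card.
  apply/fintype.properP; split; first exact: (sublevelS f_ge0 (ltW xr)).
  by exists s; rewrite mem_sublevel // sK fs ?lexx // -ltNge.
pose N k := (M k + killed F (sublevel K f (f x)) (sublevel K f r) k)%N.
exists N; split=> [k|]; last first.
  by rewrite (counting_dead_by_gap _ xr gp) ?f_ge0 // MC -EFinD -natrD.
have := killed_gap F cK f_ge0 f_morse f_vertex f_distinct k sK fs r_gt0 xr gp.
have -> : prev N k = (prev M k
   + prev (killed F (sublevel K f (f x)) (sublevel K f r)) k)%N by case: (k).
by move: (ME k); rewrite /= /N; lia.
Qed.

(** Beyond the largest value of f the complex does not change, which excludes any
    later finite death. *)
Lemma num_finite_euler : exists M : nat -> nat,
    (forall k, M k + prev M k + betti F K k = num_critical K f k)%N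
    /\ num_finite_points PD = (M q)%:R%:E.
Proof.
have [r [r0 rval rmax]] : exists r,
    [/\ 0 <= r, r = 0 \/ (exists2 s, s \in K & f s = r) & forall x, x \in K -> f x <= r].
  have [K0|/finset.set0Pn[s sK]] := eqVneq K finset.set0.
    by exists 0; split; [|left|move=> x; rewrite K0 finset.inE].
  case: (arg_maxP f (sK : mem K s)) => x xK xmax; exists (f x).
  by split; [exact: f_ge0|right; exists x|exact: xmax].
have [M [ME MC]] := dead_by_euler r0 rval; exists M; split=> [k|].
  by have := ME k; rewrite sublevel_max // critical_upto_max.
rewrite -MC; apply: eq_counting => -[b [d| |]] pd; have [b0 bd] := hPD.1 _ _ pd => //.
rewrite /dead_by /= ltry lee_fin; split=> // _; rewrite leNgt; apply/negP => rd.
have gp : gap K f r (d + 1) by move=> x /rmax; rewrite leNgt => /negPf ->.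
by have := no_death_in_gap r0 gp pd rd; rewrite leNgt ltrDl ltr01.
Qed.

End Diagram.

Lemma alternating_sum (R : pzRingType) (M x : nat -> nat) q :
  (forall k, M k + prev M k = x k)%N ->
  (M q)%:R = \sum_(i < q.+1) (-1) ^+ (q - i) * (x i)%:R :> R.
Proof.
move=> MN; elim: q => [|q IHq].
  by rewrite big_ord_recl big_ord0 expr0 mul1r addr0 -MN addn0.
rewrite big_ord_recr /= subnn expr0 mul1r -MN natrD addrCA /= IHq.
rewrite -[LHS]addr0; congr (_ + _); rewrite -big_split big1 //= => i _.
by rewrite subSn ?exprS ?mulN1r ?mulNr ?subrr ?addNr // -ltnS.
Qed.

Theorem theorem2p1 (R : realType) (F : fieldType) (T : finType)
    (K : {set {set T}}) (V : {set {set {set T}}}) (f : {set T} -> R)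
    (hK : simplicial_complex K)
    (hf_ge0 : forall s, s \in K -> 0 <= f s)
    (hf_morse : generalized_discrete_morse K V f)
    (hf_vertex : forall v : T, [set v]%SET \in K -> f [set v]%SET = 0)
    (hf_distinct : distinct_values V f)
    (q : nat) (PD : R * \bar R -> nat)
    (hPD : is_persistence_diagram F K f q PD) :
  num_finite_points PD =
    (\sum_(i < q.+1) (-1) ^+ (q - i) * (num_critical K f i)%:R
     - \sum_(i < q.+1) (-1) ^+ (q - i) * (betti F K i)%:R)%:E.
Proof.
have [M [ME ->]] := num_finite_euler hK hf_ge0 hf_morse hf_vertex hf_distinct hPD.
congr (_%:E); pose x k := (M k + prev M k)%N.
rewrite (@alternating_sum R M x q) // -sumrB; apply: eq_bigr => i _.
by rewrite -mulrBr -ME -/(x i) natrD addrK.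
Qed.
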